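(* The update operator $\oplus_2$ satisfies, for all extended logic programs $P,P_1,P_2$ and every rule $x$: (BK-1) $P\oplus_2\{x\}$ is a program; (BK-2) $P_1\oplus_2P_2\vdash_{N_2}P_2$; (BK-3) $P_1\cup P_2\vdash_{N_2}P_1\oplus_2P_2$; (BK-5) if $P_2\equiv_{N_2}\bot$ then $P_1\oplus_2P_2\equiv_{N_2}\bot$; (BK-6) if $P_1\equiv_{N_2}P_2$ then $P\oplus_2P_1$ and $P\oplus_2P_2$ have the same answer sets.
   Context: Formulas use $\wedge,\vee,\rightarrow,\bot$ and strong negation $\sim$; $\lnot F$ is $F\rightarrow\bot$, $\top$ is $\bot\rightarrow\bot$. A literal is an atom $a$ or $\sim a$; $\sim L$ denotes the complementary literal ($\sim\sim a=a$). An extended logic program (ELP) is a finite set of rules $r$: $L\leftarrow B_1,\dots,B_m,\lnot B_{m+1},\dots,\lnot B_n$ (the formula $B_1\wedge\dots\wedge\lnot B_n\rightarrow L$), $L,B_i$ literals, $\top$ or $\bot$; $H(r)=L$, $B(r)$ the body; constraint if $H(r)=\bot$. A program is a finite set of formulas $G\rightarrow l$, $l$ a literal, $G$ built from literals, $\top,\bot$ by $\wedge,\vee,\lnot$. $\mathrm{N}_2$ is intuitionistic logic plus Nelson's axioms ($\sim(\alpha\rightarrow\beta)\leftrightarrow\alpha\wedge\sim\beta$, $\sim(\alpha\wedge\beta)\leftrightarrow\sim\alpha\vee\sim\beta$, $\sim(\alpha\vee\beta)\leftrightarrow\sim\alpha\wedge\sim\beta$, $\alpha\leftrightarrow\sim\sim\alpha$,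 $\sim\lnot\alpha\leftrightarrow\alpha$, $\sim a\rightarrow\lnot a$ for atoms) and the schema $\alpha\vee(\alpha\rightarrow\beta)\vee\lnot\beta$. $T\vdash_{N_2}T'$ means $T$ derives every formula of $T'$; $T\equiv_{N_2}T'$ means mutual derivability; $T\equiv_{N_2}\bot$ means $T$ is $\mathrm{N}_2$-inconsistent. A consistent set $M$ of literals over the atoms $\mathcal{A}$ is an answer set of $T$ iff $T\cup\{\lnot l: l\in Lit_{\mathcal{A}}\setminus M\}\cup\{\lnot\lnot l:l\in M\}$ is $\mathrm{N}_2$-consistent and $\mathrm{N}_2$-derives each element of $M$. $P_1\oplus_2P_2$ consists of (i) all constraints of $P_1\cup P_2$; (ii) for each non-constraint $r\in P_1$ with $H(r)=L$, the rule $L\leftarrow B(r),\lnot\sim L$; (iii) all rules of $P_2$.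
   Formalization: In BK-1 a program may also have formulas with head ⊥ or ⊤, not only a literal; with literal heads alone BK-1 fails, since a constraint ⊥ ← a of P is kept by the update. For L = ⊤, ∼L is read as ⊥. *)

(* Defs.v *)
From mathcomp Require Import all_boot.
From mathcomp Require Import boolp classical_sets cardinality.

Set Implicit Arguments.
Unset Strict Implicit.
Unset Printing Implicit Defensive.

Local Open Scope classical_set_scope.

(** * Formulas and literals over a signature [A] of atoms *)

Inductive formula (A : Type) : Type :=
| Atom of A
| Bot
| And of formula A & formula A
| Or of formula A & formula A
| Imp of formula A & formula A
| SNeg of formula A. (* strong negation *)

Arguments Bot {A}.

Definition Neg (A : Type) (F : formula A) : formula A := Imp F Bot.
Definition Top {A : Type} : formula A := Imp Bot Bot.
Definition Iff (A : Type) (F G : formula A) : formula A :=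
  And (Imp F G) (Imp G F).

Inductive literal (A : Type) : Type := PosLit of A | NegLit of A.

Definition lit_formula (A : Type) (l : literal A) : formula A :=
  match l with PosLit a => Atom a | NegLit a => SNeg (Atom a) end.

Definition lit_compl (A : Type) (l : literal A) : literal A :=
  match l with PosLit a => NegLit a | NegLit a => PosLit a end.

(** * The logic N_2 *)

Inductive int_axiom (A : Type) : formula A -> Prop :=
| ax_K F G : int_axiom (Imp F (Imp G F))
| ax_S F G H :
    int_axiom (Imp (Imp F (Imp G H)) (Imp (Imp F G) (Imp F H)))
| ax_andI F G : int_axiom (Imp F (Imp G (And F G)))
| ax_andEl F G : int_axiom (Imp (And F G) F)
| ax_andEr F G : int_axiom (Imp (And F G) G)
| ax_orIl F G : int_axiom (Imp F (Or F G))
| ax_orIr F G : int_axiom (Imp G (Or F G))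
| ax_orE F G H :
    int_axiom (Imp (Imp F H) (Imp (Imp G H) (Imp (Or F G) H)))
| ax_botE F : int_axiom (Imp Bot F).

Inductive nelson_axiom (A : Type) : formula A -> Prop :=
| ax_snegImp F G : nelson_axiom (Iff (SNeg (Imp F G)) (And F (SNeg G)))
| ax_snegAnd F G : nelson_axiom (Iff (SNeg (And F G)) (Or (SNeg F) (SNeg G)))
| ax_snegOr F G : nelson_axiom (Iff (SNeg (Or F G)) (And (SNeg F) (SNeg G)))
| ax_snegSneg F : nelson_axiom (Iff F (SNeg (SNeg F)))
| ax_snegNeg F : nelson_axiom (Iff (SNeg (Neg F)) F)
| ax_snegAtom a : nelson_axiom (Imp (SNeg (Atom a)) (Neg (Atom a))).

Inductive N2_derives (A : Type) (T : set (formula A)) : formula A -> Prop :=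
| N2_hyp F : T F -> N2_derives T F
| N2_int F : int_axiom F -> N2_derives T F
| N2_nelson F : nelson_axiom F -> N2_derives T F
| N2_ht F G : N2_derives T (Or F (Or (Imp F G) (Neg G)))
| N2_mp F G : N2_derives T (Imp F G) -> N2_derives T F -> N2_derives T G.

Definition N2_entails (A : Type) (T T' : set (formula A)) : Prop :=
  forall F, T' F -> N2_derives T F.

Definition N2_equiv (A : Type) (T T' : set (formula A)) : Prop :=
  N2_entails T T' /\ N2_entails T' T.

Definition N2_inconsistent (A : Type) (T : set (formula A)) : Prop :=
  N2_derives T Bot.

Definition N2_consistent (A : Type) (T : set (formula A)) : Prop :=
  ~ N2_inconsistent T.

(** * Extended logic programs *)

Inductive extlit (A : Type) : Type := ELit of literal A | ETop | EBot.

Arguments ETop {A}.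
Arguments EBot {A}.

Definition extlit_formula (A : Type) (e : extlit A) : formula A :=
  match e with ELit l => lit_formula l | ETop => Top | EBot => Bot end.

(* The complement is extended to the constants in the usual way, so that
   [not ~ L] remains an admissible body element when [L] is [ETop]. N_2 proves
   [SNeg Top <-> Bot] and [SNeg Bot <-> Top]. *)
Definition extlit_compl (A : Type) (e : extlit A) : extlit A :=
  match e with ELit l => ELit (lit_compl l) | ETop => EBot | EBot => ETop end.

(* [pbody] lists B_1, .., B_m and [nbody] lists B_(m+1), .., B_n, the latter
   without their default negation. *)
Record rule (A : Type) : Type := Rule {
  rhead : extlit A;
  pbody : seq (extlit A);
  nbody : seq (extlit A)
}.

Definition list_conj (A : Type) (s : seq (formula A)) : formula A :=
  if s is F :: s' then foldl (@And A) F s' else Top.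

Definition body_formula (A : Type) (r : rule A) : formula A :=
  list_conj (map (@extlit_formula A) (pbody r) ++
        map (fun e => Neg (extlit_formula e)) (nbody r)).

Definition rule_formula (A : Type) (r : rule A) : formula A :=
  Imp (body_formula r) (extlit_formula (rhead r)).

Definition is_constraint (A : Type) (r : rule A) : Prop := rhead r = EBot.

Definition ELP (A : Type) (P : set (rule A)) : Prop := finite_set P.

Definition theory (A : Type) (P : set (rule A)) : set (formula A) :=
  [set rule_formula r | r in P].

(** * Programs *)

Inductive program_body (A : Type) : formula A -> Prop :=
| pb_lit l : program_body (lit_formula l)
| pb_top : program_body Top
| pb_bot : program_body Bot
| pb_and F G : program_body F -> program_body G -> program_body (And F G)
| pb_or F G : program_body F -> program_body G -> program_body (Or F G)
| pb_neg F : program_body F -> program_body (Neg F).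

(* As in extended logic programs, heads may also be [Bot] (constraints) or
   [Top]; otherwise an ELP with a constraint would not be a program. *)
Definition is_program (A : Type) (T : set (formula A)) : Prop :=
  finite_set T /\
  forall F, T F -> exists (G : formula A) (e : extlit A),
    program_body G /\ F = Imp G (extlit_formula e).

(** * Answer sets *)

Definition lit_consistent (A : Type) (M : set (literal A)) : Prop :=
  forall l, ~ (M l /\ M (lit_compl l)).

Definition completion (A : Type) (T : set (formula A)) (M : set (literal A)) :
    set (formula A) :=
  T `|` [set Neg (lit_formula l) | l in ~` M]
    `|` [set Neg (Neg (lit_formula l)) | l in M].

Definition answer_sets (A : Type) (T : set (formula A)) :
    set (set (literal A)) :=
  [set M | lit_consistent M /\
           N2_consistent (completion T M) /\
           forall l, M l -> N2_derives (completion T M) (lit_formula l)].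

(** * The update operator *)

Definition weaken (A : Type) (r : rule A) : rule A :=
  Rule (rhead r) (pbody r) (rcons (nbody r) (extlit_compl (rhead r))).

Definition update2 (A : Type) (P1 P2 : set (rule A)) : set (rule A) :=
  [set r | (P1 `|` P2) r /\ is_constraint r]
  `|` [set weaken r | r in [set r | P1 r /\ ~ is_constraint r]]
  `|` P2.

(* Main.v *)
Require Import Defs.
From mathcomp Require Import all_boot.
From mathcomp Require Import boolp classical_sets cardinality.

Local Open Scope classical_set_scope.

(** As a theory, the update is a part depending only on the first program together with all of the
    second ([theory_update2]). Hence BK-2, and BK-5 by cut ([N2_derives_trans]). For BK-3, [weaken]
    only adds a conjunct to the body, so the weakened rule follows from the original
    ([rule_formula_weaken]). For BK-6, the splitting survives completion, so equivalent second
    programs give equivalent completions, and answer sets depend on completions only up to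
    equivalence ([answer_sets_sub]). BK-1 is finiteness plus the shape of bodies. *)

Lemma N2_derives_trans (A : Type) (T T' : set (formula A)) (F : formula A) :
  N2_entails T T' -> N2_derives T' F -> N2_derives T F.
Proof.
move=> TT'; elim=> {F} [F /TT' //|F ax|F ax|F G|F G _ IH1 _ IH2].
- exact: N2_int.
- exact: N2_nelson.
- exact: N2_ht.
- exact: N2_mp IH1 IH2.
Qed.

Lemma N2_entails_sub (A : Type) (T T' : set (formula A)) :
  T' `<=` T -> N2_entails T T'.
Proof. by move=> sub F /sub; exact: N2_hyp. Qed.

Lemma N2_entailsU (A : Type) (T T1 T2 : set (formula A)) :
  N2_entails T1 T2 -> N2_entails (T `|` T1) (T `|` T2).
Proof.
move=> T12 F [TF|/T12]; first by apply: N2_hyp; left.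
by apply: N2_derives_trans; apply: N2_entails_sub => G; right.
Qed.

Lemma N2_imp_weak (A : Type) (T : set (formula A)) (F G : formula A) :
  N2_derives T G -> N2_derives T (Imp F G).
Proof. by apply: N2_mp; apply/N2_int/ax_K. Qed.

Lemma N2_imp_trans (A : Type) (T : set (formula A)) (F G H : formula A) :
  N2_derives T (Imp F G) -> N2_derives T (Imp G H) -> N2_derives T (Imp F H).
Proof.
move=> FG GH; apply: N2_mp FG.
by apply: N2_mp (N2_imp_weak _ _ F _ GH); apply/N2_int/ax_S.
Qed.

(** Conjunctions nest to the left, so an appended formula is the outermost right conjunct, except
    that a singleton carries no leading [Top]. *)
Lemma list_conj_rcons (A : Type) (s : seq (formula A)) (F : formula A) :
  list_conj (rcons s F) = if s is [::] then F else And (list_conj s) F.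
Proof. by case: s => //= G s; rewrite -cats1 foldl_cat. Qed.

Lemma body_formula_weaken (A : Type) (T : set (formula A)) (r : rule A) :
  N2_derives T (Imp (body_formula (weaken r)) (body_formula r)).
Proof.
rewrite /body_formula /= map_rcons -rcons_cat list_conj_rcons.
case: (_ ++ _) => [|F s]; last exact/N2_int/ax_andEl.
(* The original body is empty, hence [Top], which is the instance [Imp Bot Bot] of ex falso. *)
exact/N2_imp_weak/N2_int/ax_botE.
Qed.

Lemma rule_formula_weaken (A : Type) (T : set (formula A)) (r : rule A) :
  N2_derives T (rule_formula r) -> N2_derives T (rule_formula (weaken r)).
Proof. exact/N2_imp_trans/body_formula_weaken. Qed.

Lemma extlit_program_body (A : Type) (e : extlit A) :
  program_body (extlit_formula e).
Proof. by case: e => [l||] /=; [exact: pb_lit|exact: pb_top|exact: pb_bot]. Qed.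

Lemma body_formula_program_body (A : Type) (r : rule A) :
  program_body (body_formula r).
Proof.
rewrite /body_formula; case: r => h p n /=; elim/last_ind: n => [|n e IH].
  rewrite cats0; elim/last_ind: p => [|p e IH]; first exact: pb_top.
  rewrite map_rcons list_conj_rcons.
  case: (map _ _) IH => [|F s] IH; first exact: extlit_program_body.
  exact/pb_and/extlit_program_body.
rewrite map_rcons -rcons_cat list_conj_rcons.
case: (_ ++ _) IH => [|F s] IH; first exact/pb_neg/extlit_program_body.
exact/pb_and/pb_neg/extlit_program_body.
Qed.

Lemma is_program_theory (A : Type) (P : set (rule A)) :
  ELP P -> is_program (theory P).
Proof.
move=> finP; split; first exact: finite_image.
move=> _ [r _ <-]; exists (body_formula r), (rhead r).
by split; first exact: body_formula_program_body.
Qed.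

Lemma ELP_update2 (A : Type) (P1 P2 : set (rule A)) :
  ELP P1 -> ELP P2 -> ELP (update2 P1 P2).
Proof.
move=> finP1 finP2; rewrite /ELP !finite_setU; split=> //; split.
  by apply: (@sub_finite_set _ _ (P1 `|` P2)) => [r []|]; rewrite ?finite_setU.
by apply/finite_image/(sub_finite_set _ finP1) => r [].
Qed.

(* The constraints of [P2] already belong to [P2], so [P2] enters the update
   only as a whole. *)
Lemma theory_update2 (A : Type) (P1 P2 : set (rule A)) :
  theory (update2 P1 P2) = theory (update2 P1 set0) `|` theory P2.
Proof.
rewrite /theory -image_setU; congr image; rewrite /update2 !setU0.
apply/seteqP; split=> r.
  by move=> [[[[P1r|P2r] Cr]|Wr]|P2r]; [left; left|right|left; right|right].
by move=> [[[P1r Cr]|Wr]|P2r]; [left; left; split=> //; left|left; right|right].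
Qed.

(** The formulas added by completion depend on [M] alone, so [theory Q] can be isolated and
    exchanged for an equivalent theory. *)
Lemma completion_theory_update2 (A : Type) (P Q : set (rule A))
    (M : set (literal A)) :
  completion (theory (update2 P Q)) M =
  completion (theory (update2 P set0)) M `|` theory Q.
Proof.
rewrite theory_update2 /completion.
by rewrite [in RHS]setUAC (setUAC (theory (update2 P set0)) _ (theory Q)).
Qed.

(** Consistency transfers along one direction of the equivalence, derivability of the literals of
    [M] along the other. *)
Lemma answer_sets_sub (A : Type) (T T' : set (formula A)) :
  (forall M, N2_equiv (completion T M) (completion T' M)) ->
  answer_sets T `<=` answer_sets T'.
Proof.
move=> TT' M [consM [consT derT]]; have [le ge] := TT' M.
split=> //; split=> [inc|l /derT]; last exact: N2_derives_trans.
exact/consT/(N2_derives_trans _ _ _ _ le).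
Qed.

Theorem theorem4p5 (A : Type) (P P1 P2 : set (rule A)) (x : rule A)
    (hP : ELP P) (hP1 : ELP P1) (hP2 : ELP P2) :
  (* BK-1 *) is_program (theory (update2 P [set x])) /\
  (* BK-2 *) N2_entails (theory (update2 P1 P2)) (theory P2) /\
  (* BK-3 *) N2_entails (theory (P1 `|` P2)) (theory (update2 P1 P2)) /\
  (* BK-5 *) (N2_inconsistent (theory P2) ->
              N2_inconsistent (theory (update2 P1 P2))) /\
  (* BK-6 *) (N2_equiv (theory P1) (theory P2) ->
              answer_sets (theory (update2 P P1)) =
              answer_sets (theory (update2 P P2))).
Proof.
have BK2 : N2_entails (theory (update2 P1 P2)) (theory P2).
  by apply: N2_entails_sub => F; rewrite theory_update2; right.
split; first exact/is_program_theory/ELP_update2/finite_set1.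
split=> //; split.
  move=> _ [r + <-] => -[[[P12r _]|[r' [P1r' _] <-]]|P2r].
  - by apply: N2_hyp; exists r.
  - by apply/rule_formula_weaken/N2_hyp; exists r' => //; left.
  - by apply: N2_hyp; exists r => //; right.
split; first exact: N2_derives_trans.
(* Both completions share the part coming from [P] and [M]; only [theory P1] and [theory P2] are
   interchanged. *)
move=> [le ge]; apply/seteqP; split; apply: answer_sets_sub => M;
  rewrite (completion_theory_update2 _ _ P1) (completion_theory_update2 _ _ P2);
  by split; exact: N2_entailsU.
Qed.
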